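(* Let $\rho,\sigma,\Delta>0$, $b\ge 0$, $c>0$, and let $\alpha,x_v,y_v,\theta,k_2,k_0,\xi,\bar c$ and $\varphi_{A_1,A_2}$ be as defined in the context. Assume $c<\bar c$. Then there exists a unique solution $(A_1,A_2,\underline{x},\bar x,x^* )\in\mathbb{R}^5$ to the system consisting of the order condition $$0<\underline{x}<x^*<\bar x<\Delta$$ and the conditions $$\begin{cases}\varphi_{A_1,A_2}'(x^* )=0 \ \text{ and }\ \varphi_{A_1,A_2}''(x^* )<0,\\ \varphi_{A_1,A_2}'(\underline{x})=0,\\ \varphi_{A_1,A_2}'(\bar x)=0,\\ \varphi_{A_1,A_2}(\underline{x})=\varphi_{A_1,A_2}(x^* )-c,\\ \varphi_{A_1,A_2}(\bar x)=\varphi_{A_1,A_2}(x^* )-c,\end{cases}$$ so that the function $\tilde V:\mathbb{R}\to\mathbb{R}$, $\tilde V(x)=\varphi_{A_1,A_2}(x)$ for $x\in\,]\underline{x},\bar x[$ and $\tilde V(x)=\varphi_{A_1,A_2}(x^* )-c$ for $x\in\mathbb{R}\setminus\,]\underline{x},\bar x[$, is well-defined. This solution is given by $$A_1=Ae^{-\theta x_v},\qquad A_2=Ae^{\theta x_v},\qquad x^*=x_v,\qquad \underline{x}=x_v-\bar y,\qquad \bar x=x_v+\bar y,$$ where $(A,\bar y)$ is the unique solution to $$\begin{cases}A\theta e^{\theta\bar y}-A\theta e^{-\theta\bar y}-2k_2\bar y=0,\\ Ae^{\theta\bar y}+Ae^{-\theta\bar y}-k_2\bar y^2-2A+c=0,\\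 A>0,\ \bar y>0,\end{cases}\qquad\text{with}\quad \bar y<\Delta-x_v.$$
   Context: Constants: $\rho,\sigma,\Delta>0$, $b\ge0$, $c>0$, and $$\alpha=\frac{\Delta+b}{\Delta^2},\quad x_v=\frac{\Delta(\Delta+2b)}{2(\Delta+b)},\quad y_v=\frac{\Delta^2}{4(\Delta+b)},\quad \theta=\sqrt{\frac{2\rho}{\sigma^2}},\quad k_2=\frac{\alpha}{\rho},\quad k_0=\frac{y_v}{\rho}-\frac{2k_2}{\theta^2}.$$ For $A_1,A_2\in\mathbb{R}$ and $x\in\mathbb{R}$, $\varphi_{A_1,A_2}(x)=A_1e^{\theta x}+A_2e^{-\theta x}-k_2(x-x_v)^2+k_0$. For $y>0$, $$\xi(y)=k_2y^2-\frac{2k_2}{\theta}\,\frac{e^{\theta y}+e^{-\theta y}-2}{e^{\theta y}-e^{-\theta y}}\,y,\qquad \bar c=\xi(\Delta-x_v).$$ Notation: $]a,b[$ is the open interval with endpoints $a,b$. *)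

(* Defs.v *)
From Stdlib Require Import Reals.
From Coquelicot Require Import Coquelicot.
Open Scope R_scope.

Definition alpha (Delta b : R) : R := (Delta + b) / Delta ^ 2.
Definition x_v (Delta b : R) : R := Delta * (Delta + 2 * b) / (2 * (Delta + b)).
Definition y_v (Delta b : R) : R := Delta ^ 2 / (4 * (Delta + b)).
Definition theta (rho sigma : R) : R := sqrt (2 * rho / sigma ^ 2).
Definition k2 (rho Delta b : R) : R := alpha Delta b / rho.
Definition k0 (rho sigma Delta b : R) : R :=
  y_v Delta b / rho - 2 * k2 rho Delta b / theta rho sigma ^ 2.

Definition phi (rho sigma Delta b A1 A2 x : R) : R :=
  A1 * exp (theta rho sigma * x) + A2 * exp (- theta rho sigma * x)
  - k2 rho Delta b * (x - x_v Delta b) ^ 2 + k0 rho sigma Delta b.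

(* Only meaningful for [0 < y], so that the denominator is nonzero. *)
Definition xi (rho sigma Delta b y : R) : R :=
  let th := theta rho sigma in
  k2 rho Delta b * y ^ 2
  - 2 * k2 rho Delta b / th
    * ((exp (th * y) + exp (- th * y) - 2) / (exp (th * y) - exp (- th * y)))
    * y.

Definition c_bar (rho sigma Delta b : R) : R :=
  xi rho sigma Delta b (Delta - x_v Delta b).

(* Components are listed as (A1, A2, lower x, upper x, x* ).
   [Derive] and [Derive_n] are the genuine derivatives here, [phi] being
   smooth in its last argument. *)
Definition solves_system (rho sigma Delta b c : R)
    (s : R * R * R * R * R) : Prop :=
  let '(A1, A2, xl, xu, xs) := s in
  let f := phi rho sigma Delta b A1 A2 in
  (0 < xl /\ xl < xs /\ xs < xu /\ xu < Delta) /\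
  (Derive f xs = 0 /\ Derive_n f 2 xs < 0) /\
  Derive f xl = 0 /\
  Derive f xu = 0 /\
  f xl = f xs - c /\
  f xu = f xs - c.

Definition is_Vtilde (rho sigma Delta b c : R)
    (s : R * R * R * R * R) (V : R -> R) : Prop :=
  let '(A1, A2, xl, xu, xs) := s in
  let f := phi rho sigma Delta b A1 A2 in
  forall x : R,
    (xl < x < xu -> V x = f x) /\
    (~ (xl < x < xu) -> V x = f xs - c).

Definition solves_reduced_system (rho sigma Delta b c : R)
    (q : R * R) : Prop :=
  let '(A, y) := q in
  let th := theta rho sigma in
  let k := k2 rho Delta b in
  A * th * exp (th * y) - A * th * exp (- th * y) - 2 * k * y = 0 /\
  A * exp (th * y) + A * exp (- th * y) - k * y ^ 2 - 2 * A + c = 0 /\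
  A > 0 /\ y > 0.

(* Main.v *)
Require Import Defs.
From Stdlib Require Import Reals Lra FunctionalExtensionality.
From Coquelicot Require Import Coquelicot.
Open Scope R_scope.

(** Around any centre [z], [phi] is a combination of [cosh (theta (x - z))] and
    [sinh (theta (x - z))] minus the parabola [k2 (x - x_v)^2], up to a constant.
    Three facts on [t > 0] drive everything: [t - tanh t] increases from [0], its
    derivative being [tanh t ^ 2]; hence [sinh t / t] is increasing, its derivative
    having the sign of [t - tanh t]; and [t < sinh t].

    Symmetry.  Take [z] to be the midpoint of the two outer critical points and
    let [h] be half their distance.  Equality of the two values and the sum of the
    two first-order conditions are linear in the sinh-amplitude [Q] and in the
    offset [m = z - x_v].  Eliminating [Q] leaves
    [m (theta h cosh (theta h) - sinh (theta h)) = 0], so that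
    [m = 0] and then [Q = 0] ([no_antisymmetric_part]): the function is
    [2 A cosh (theta (x - x_v)) - k2 (x - x_v)^2 + k0].  Its critical points off
    [x_v] have [sinh (theta |x - x_v|) / |x - x_v|] prescribed, hence lie at one
    distance from [x_v] only, and the inner critical point has to be [x_v] itself
    ([inner_critical_point]).  What remains of the five conditions is the reduced
    system for [(A, ybar)] ([system_reduces]); conversely [t < sinh t] gives
    the strict concavity at [x_v] ([system_of_reduced]).

    Reduced system.  Its first equation determines [A] from [ybar], and the second
    one then reads [xi ybar = c] ([reduced_system_iff]).  The half-angle formula
    turns [xi y] into [(4 k2 / theta^2) t (t - tanh t)] at [t = theta y / 2].  This
    is continuous, vanishes at [0] and is a product of increasing nonnegative
    functions, so [c < xi (Delta - x_v)] yields exactly one root, and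
    that root lies below [Delta - x_v]. *)

(** * Hyperbolic inequalities *)

Lemma lt_of_pos_derivative (f df : R -> R) (a b : R) :
  a < b ->
  (forall x, a <= x <= b -> is_derive f x (df x)) ->
  (forall x, a < x < b -> 0 < df x) ->
  f a < f b.
Proof.
  intros hab hf hdf.
  destruct (MVT_cor2 f df a b hab) as [x [hx hxab]].
  { intros x hx. now apply is_derive_Reals, hf. }
  assert (0 < df x * (b - a)) by (apply Rmult_lt_0_compat; [now apply hdf | lra]).
  lra.
Qed.

Lemma is_derive_sinh x : is_derive sinh x (cosh x).
Proof. apply is_derive_Reals, derivable_pt_lim_sinh. Qed.

Lemma is_derive_cosh x : is_derive cosh x (sinh x).
Proof. apply is_derive_Reals, derivable_pt_lim_cosh. Qed.

Lemma cosh_pos x : 0 < cosh x.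
Proof.
  unfold cosh. pose proof (exp_pos x). pose proof (exp_pos (- x)). lra.
Qed.

Lemma sinh_pos x : 0 < x -> 0 < sinh x.
Proof. intros hx. rewrite <- sinh_0. now apply sinh_lt. Qed.

Lemma sinh_opp x : sinh (- x) = - sinh x.
Proof. unfold sinh. rewrite Ropp_involutive. lra. Qed.

Lemma cosh_opp x : cosh (- x) = cosh x.
Proof. unfold cosh. rewrite Ropp_involutive. lra. Qed.

Lemma cosh2_sinh2 x : cosh x ^ 2 - sinh x ^ 2 = 1.
Proof.
  unfold cosh, sinh.
  assert (exp x * exp (- x) = 1) by (rewrite <- exp_plus, Rplus_opp_r; apply exp_0).
  nra.
Qed.

Lemma cosh_gt_1 x : 0 < x -> 1 < cosh x.
Proof.
  intros hx. pose proof (sinh_pos x hx). pose proof (cosh_pos x).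
  pose proof (cosh2_sinh2 x). nra.
Qed.

Lemma is_derive_id_sub_tanh x : is_derive (fun t => t - tanh t) x (tanh x ^ 2).
Proof.
  pose proof (cosh_pos x) as hx.
  unfold tanh.
  replace ((sinh x / cosh x) ^ 2)
    with (1 - (cosh x * cosh x - sinh x * sinh x) / cosh x ^ 2) by (field; lra).
  apply (is_derive_minus (fun t : R => t)).
  - apply (is_derive_id (K := R_AbsRing)).
  - apply is_derive_div; [apply is_derive_sinh | apply is_derive_cosh | lra].
Qed.

Lemma id_sub_tanh_increasing x y : 0 <= x < y -> x - tanh x < y - tanh y.
Proof.
  intros hxy.
  apply (lt_of_pos_derivative (fun t => t - tanh t) (fun t => tanh t ^ 2)); [lra | |].
  - intros t _. apply is_derive_id_sub_tanh.
  - intros t ht. apply pow_lt, Rdiv_lt_0_compat; [apply sinh_pos; lra | apply cosh_pos].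
Qed.

Lemma tanh_lt_id x : 0 < x -> tanh x < x.
Proof.
  intros hx. pose proof (id_sub_tanh_increasing 0 x ltac:(lra)) as h.
  unfold tanh at 1 in h. rewrite sinh_0, cosh_0 in h. lra.
Qed.

Lemma sinh_lt_mul_cosh x : 0 < x -> sinh x < x * cosh x.
Proof.
  intros hx. pose proof (cosh_pos x).
  replace (sinh x) with (tanh x * cosh x) by (unfold tanh; field; lra).
  now apply Rmult_lt_compat_r, tanh_lt_id.
Qed.

Lemma id_lt_sinh x : 0 < x -> x < sinh x.
Proof.
  intros hx.
  enough (sinh 0 - 0 < sinh x - x) by (rewrite sinh_0 in *; lra).
  apply (lt_of_pos_derivative (fun t => sinh t - t) (fun t => cosh t - 1)); [easy | |].
  - intros t _. apply (is_derive_minus sinh).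
    + apply is_derive_sinh.
    + apply (is_derive_id (K := R_AbsRing)).
  - intros t ht. pose proof (cosh_gt_1 t ltac:(lra)). lra.
Qed.

Lemma sinh_div_id_increasing x y : 0 < x < y -> sinh x / x < sinh y / y.
Proof.
  intros hxy.
  apply (lt_of_pos_derivative (fun t => sinh t / t)
           (fun t => (cosh t * t - 1 * sinh t) / t ^ 2)); [lra | |].
  - intros t ht. rewrite (Rmult_comm 1), Rmult_1_r.
    replace (cosh t * t - sinh t) with (cosh t * t - sinh t * 1) by ring.
    apply (is_derive_div sinh (fun t : R => t)).
    + apply is_derive_sinh.
    + apply (is_derive_id (K := R_AbsRing)).
    + lra.
  - intros t ht. apply Rdiv_lt_0_compat; [| apply pow_lt; lra].
    pose proof (sinh_lt_mul_cosh t ltac:(lra)). lra.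
Qed.

(** * The reduced system *)

(** The increasing profile to which [xi] rescales. *)
Definition profile (t : R) : R := t * (t - tanh t).

Lemma profile_increasing x y : 0 <= x < y -> profile x < profile y.
Proof.
  intros hxy. unfold profile.
  pose proof (id_sub_tanh_increasing x y hxy) as h.
  assert (0 <= x - tanh x).
  { destruct (proj1 hxy) as [h0 | <-]; [pose proof (tanh_lt_id x h0); lra |].
    unfold tanh. rewrite sinh_0, cosh_0. lra. }
  apply Rmult_le_0_lt_compat; lra.
Qed.

Lemma profile_0 : profile 0 = 0.
Proof. unfold profile. ring. Qed.

Lemma continuity_profile : continuity profile.
Proof.
  intros t. apply continuity_pt_mult.
  - apply derivable_continuous_pt, derivable_pt_id.
  - apply continuity_pt_filterlim, (ex_derive_continuous (fun t => t - tanh t)).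
    eexists. apply is_derive_id_sub_tanh.
Qed.

(** Half-angle formula, [(cosh (2 t) - 1) / sinh (2 t) = tanh t], in the form in
    which [xi] uses it. *)
Lemma half_angle s : 0 < s ->
  (exp s + exp (- s) - 2) / (exp s - exp (- s)) = tanh (s / 2).
Proof.
  intros hs.
  pose proof (sinh_pos (s / 2) ltac:(lra)) as hsh.
  pose proof (cosh_pos (s / 2)) as hch.
  pose proof (cosh2_sinh2 (s / 2)) as h1.
  assert (hp : exp s = exp (s / 2) * exp (s / 2)) by (rewrite <- exp_plus; f_equal; lra).
  assert (hm : exp (- s) = exp (- (s / 2)) * exp (- (s / 2)))
    by (rewrite <- exp_plus; f_equal; lra).
  assert (hn : exp s + exp (- s) - 2 = 4 * sinh (s / 2) ^ 2).
  { rewrite hp, hm. unfold cosh, sinh in *. lra. }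
  assert (hd : exp s - exp (- s) = 4 * sinh (s / 2) * cosh (s / 2)).
  { rewrite hp, hm. unfold cosh, sinh. lra. }
  rewrite hn, hd. unfold tanh. field. lra.
Qed.

Section Model.

Variables rho sigma Delta b c : R.
Hypotheses (hrho : 0 < rho) (hsigma : 0 < sigma) (hDelta : 0 < Delta) (hb : 0 <= b).

Local Notation th := (theta rho sigma).
Local Notation k := (k2 rho Delta b).
Local Notation xv := (x_v Delta b).
Local Notation f A1 A2 := (phi rho sigma Delta b A1 A2).

Lemma theta_pos : 0 < th.
Proof.
  apply sqrt_lt_R0, Rdiv_lt_0_compat; [lra |]. now apply pow_lt.
Qed.

Lemma k2_pos : 0 < k.
Proof.
  apply Rdiv_lt_0_compat; [| easy]. apply Rdiv_lt_0_compat; [lra |]. now apply pow_lt.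
Qed.

Lemma x_v_lt_Delta : xv < Delta.
Proof.
  enough (0 < Delta - xv) by lra.
  replace (Delta - xv) with (Delta ^ 2 / (2 * (Delta + b)))
    by (unfold x_v; field; lra).
  apply Rdiv_lt_0_compat; [now apply pow_lt | lra].
Qed.

(** Because of this, [ybar < Delta - x_v] also keeps [x_v - ybar] positive. *)
Lemma upper_room_le_lower_room : Delta - xv <= xv.
Proof.
  enough (0 <= 2 * xv - Delta) by lra.
  replace (2 * xv - Delta) with (Delta * b / (Delta + b)) by (unfold x_v; field; lra).
  apply Rdiv_le_0_compat; [apply Rmult_le_pos; lra | lra].
Qed.

Lemma xi_profile y : 0 < y ->
  xi rho sigma Delta b y = 4 * k / th ^ 2 * profile (th * y / 2).
Proof.
  intros hy. pose proof theta_pos as hth.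
  unfold xi, profile. cbv zeta.
  rewrite Ropp_mult_distr_l_reverse, half_angle by now apply Rmult_lt_0_compat.
  field. lra.
Qed.

Lemma xi_increasing x y : 0 < x < y ->
  xi rho sigma Delta b x < xi rho sigma Delta b y.
Proof.
  intros hxy. pose proof theta_pos as hth. pose proof k2_pos as hk.
  rewrite !xi_profile by lra.
  apply Rmult_lt_compat_l; [apply Rdiv_lt_0_compat; [lra | now apply pow_lt] |].
  apply profile_increasing. nra.
Qed.

Lemma xi_injective x y : 0 < x -> 0 < y ->
  xi rho sigma Delta b x = xi rho sigma Delta b y -> x = y.
Proof.
  intros hx hy h.
  destruct (Rtotal_order x y) as [l | [e | l]]; [| easy |].
  - pose proof (xi_increasing x y ltac:(lra)). lra.
  - pose proof (xi_increasing y x ltac:(lra)). lra.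
Qed.

Lemma xi_root Y : 0 < c -> 0 < Y -> c < xi rho sigma Delta b Y ->
  exists y, 0 < y < Y /\ xi rho sigma Delta b y = c.
Proof.
  intros hc hY hcY. pose proof theta_pos as hth. pose proof k2_pos as hk.
  set (r := 4 * k / th ^ 2).
  assert (hr : 0 < r) by (apply Rdiv_lt_0_compat; [lra | now apply pow_lt]).
  rewrite xi_profile in hcY by easy. fold r in hcY.
  assert (hcr : 0 < c / r < profile (th * Y / 2)).
  { split; [now apply Rdiv_lt_0_compat |].
    apply (Rmult_lt_reg_l r); [easy |].
    now replace (r * (c / r)) with c by (field; lra). }
  destruct (IVT_gen profile 0 (th * Y / 2) (c / r) continuity_profile)
    as [t [ht hpt]].
  { rewrite profile_0, Rmin_left, Rmax_right; lra. }
  assert (0 < th * Y) by now apply Rmult_lt_0_compat.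
  rewrite Rmin_left, Rmax_right in ht by lra.
  assert (t <> 0) by (intros ->; rewrite profile_0 in hpt; lra).
  assert (t <> th * Y / 2) by (intros ->; lra).
  exists (2 * t / th).
  assert (hy : 0 < 2 * t / th) by (apply Rdiv_lt_0_compat; lra).
  split.
  - split; [easy |]. apply (Rmult_lt_reg_l th); [easy |].
    replace (th * (2 * t / th)) with (2 * t) by (field; lra). lra.
  - rewrite xi_profile by easy. fold r.
    replace (th * (2 * t / th) / 2) with t by (field; lra).
    rewrite hpt. field. lra.
Qed.

Lemma reduced_system_hyperbolic A y :
  solves_reduced_system rho sigma Delta b c (A, y) <->
  th * A * sinh (th * y) = k * y /\
  2 * A * cosh (th * y) - k * y ^ 2 = 2 * A - c /\ 0 < A /\ 0 < y.
Proof.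
  unfold solves_reduced_system, sinh, cosh. cbv zeta.
  rewrite Ropp_mult_distr_l_reverse. split; intros (h1 & h2 & h3); repeat split; lra.
Qed.

Lemma reduced_system_iff A y :
  solves_reduced_system rho sigma Delta b c (A, y) <->
  A = k * y / (th * sinh (th * y)) /\ 0 < y /\ xi rho sigma Delta b y = c.
Proof.
  pose proof theta_pos as hth. pose proof k2_pos as hk.
  (* [xi] is the second equation with [A] eliminated through the first one. *)
  assert (hxi : forall y, 0 < y ->
    xi rho sigma Delta b y
    = k * y ^ 2 - 2 * (k * y / (th * sinh (th * y))) * (cosh (th * y) - 1)).
  { intros z hz. pose proof (sinh_pos (th * z) ltac:(now apply Rmult_lt_0_compat)) as hs.
    unfold xi. cbv zeta. rewrite Ropp_mult_distr_l_reverse.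
    unfold sinh, cosh in *. field. lra. }
  rewrite reduced_system_hyperbolic. split.
  - intros (h1 & h2 & hA & hy).
    pose proof (sinh_pos (th * y) ltac:(now apply Rmult_lt_0_compat)) as hs.
    assert (e : A = k * y / (th * sinh (th * y))) by (rewrite <- h1; field; lra).
    repeat split; [easy | easy |]. rewrite hxi, <- e by easy. lra.
  - intros (e & hy & hc).
    pose proof (sinh_pos (th * y) ltac:(now apply Rmult_lt_0_compat)) as hs.
    rewrite hxi, <- e in hc by easy.
    repeat split; [rewrite e; field; lra | lra | | easy].
    rewrite e. apply Rdiv_lt_0_compat; now apply Rmult_lt_0_compat.
Qed.

Lemma reduced_system_unique_solution Y :
  0 < c -> 0 < Y -> c < xi rho sigma Delta b Y ->
  exists A y, unique (solves_reduced_system rho sigma Delta b c) (A, y) /\ y < Y.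
Proof.
  intros hc hY hcY.
  destruct (xi_root Y hc hY hcY) as [y [hy hxi]].
  exists (k * y / (th * sinh (th * y))), y.
  split; [split | easy].
  - now apply reduced_system_iff.
  - intros [A' y'] h'. apply reduced_system_iff in h' as (-> & hy' & hxi').
    now replace y' with y by (apply xi_injective; [easy | easy | congruence]).
Qed.

(** * Critical points of the candidate functions *)

Definition dphi (A1 A2 x : R) : R :=
  th * (A1 * exp (th * x) - A2 * exp (- th * x)) - 2 * k * (x - xv).

Definition ddphi (A1 A2 x : R) : R :=
  th ^ 2 * (A1 * exp (th * x) + A2 * exp (- th * x)) - 2 * k.

Lemma Derive_phi A1 A2 x : Derive (f A1 A2) x = dphi A1 A2 x.
Proof.
  apply is_derive_unique. unfold phi, dphi. auto_derive; [easy |]. ring.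
Qed.

Lemma Derive2_phi A1 A2 x : Derive_n (f A1 A2) 2 x = ddphi A1 A2 x.
Proof.
  simpl. rewrite (Derive_ext _ (dphi A1 A2)) by apply Derive_phi.
  apply is_derive_unique. unfold dphi, ddphi. auto_derive; [easy |]. ring.
Qed.

(** The amplitudes of [phi] with respect to [cosh] and [sinh] centred at [z]. *)
Definition even_amplitude (A1 A2 z : R) : R := A1 * exp (th * z) + A2 * exp (- th * z).
Definition odd_amplitude (A1 A2 z : R) : R := A1 * exp (th * z) - A2 * exp (- th * z).

Lemma exp_recentre t z u : exp (t * (z + u)) = exp (t * z) * exp (t * u).
Proof. now rewrite Rmult_plus_distr_l, exp_plus. Qed.

Lemma phi_recentred A1 A2 z u :
  f A1 A2 (z + u) =
    even_amplitude A1 A2 z * cosh (th * u) + odd_amplitude A1 A2 z * sinh (th * u)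
    - k * (z - xv + u) ^ 2 + k0 rho sigma Delta b.
Proof.
  unfold phi, even_amplitude, odd_amplitude, cosh, sinh.
  rewrite !exp_recentre, !Ropp_mult_distr_l_reverse. field.
Qed.

Lemma dphi_recentred A1 A2 z u :
  dphi A1 A2 (z + u) =
    th * (even_amplitude A1 A2 z * sinh (th * u) + odd_amplitude A1 A2 z * cosh (th * u))
    - 2 * k * (z - xv + u).
Proof.
  unfold dphi, even_amplitude, odd_amplitude, cosh, sinh.
  rewrite !exp_recentre, !Ropp_mult_distr_l_reverse. field.
Qed.

(** Here [m] is the offset of the midpoint of two critical points from the vertex
    of the parabola, [h] half their distance and [Q] the odd amplitude at the
    midpoint.  Eliminating [Q] leaves [m] times a positive factor, because
    [sinh s < s cosh s]. *)
Lemma no_antisymmetric_part Q m h :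
  0 < h ->
  Q * sinh (th * h) = 2 * k * m * h ->
  th * Q * cosh (th * h) = 2 * k * m ->
  m = 0 /\ Q = 0.
Proof.
  intros hh e1 e2. pose proof theta_pos as hth. pose proof k2_pos as hk.
  assert (hs : 0 < th * h) by now apply Rmult_lt_0_compat.
  pose proof (sinh_lt_mul_cosh _ hs) as hlt.
  pose proof (sinh_pos _ hs) as hsinh.
  assert (hm : 2 * k * m * (th * h * cosh (th * h) - sinh (th * h)) = 0).
  { replace (2 * k * m * (th * h * cosh (th * h) - sinh (th * h)))
      with (th * cosh (th * h) * (2 * k * m * h) - 2 * k * m * sinh (th * h)) by ring.
    rewrite <- e1, <- e2. ring. }
  assert (m0 : m = 0).
  { apply Rmult_integral in hm as [hm | hm]; [| lra].
    apply Rmult_integral in hm as [hm | hm]; lra. }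
  split; [easy |]. rewrite m0 in e1.
  apply (Rmult_eq_reg_r (sinh (th * h))); lra.
Qed.

(** Off the centre a critical point [u] has [sinh (th |u|) / |u| = 2 k / (th P)],
    and [sinh s / s] is injective. *)
Lemma inner_critical_point P h u :
  - h < u < h ->
  th * P * sinh (th * h) = 2 * k * h ->
  th * P * sinh (th * u) = 2 * k * u ->
  u = 0.
Proof.
  pose proof theta_pos as hth. pose proof k2_pos as hk.
  assert (pos : forall v, 0 < v < h ->
    th * P * sinh (th * h) = 2 * k * h -> th * P * sinh (th * v) = 2 * k * v -> False).
  { intros v hv eh ev.
    pose proof (sinh_div_id_increasing (th * v) (th * h) ltac:(nra)) as hlt.
    assert (hv' : 0 < th * v) by (apply Rmult_lt_0_compat; lra).
    assert (hh' : 0 < th * h) by (apply Rmult_lt_0_compat; lra).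
    pose proof (sinh_pos _ hv') as hs.
    assert (hP : 0 < P).
    { apply (Rmult_lt_reg_r (th * sinh (th * v))); [now apply Rmult_lt_0_compat |].
      assert (0 < k * v) by (apply Rmult_lt_0_compat; lra). lra. }
    assert (hlt' : P * (sinh (th * v) / (th * v)) < P * (sinh (th * h) / (th * h)))
      by now apply Rmult_lt_compat_l.
    replace (P * (sinh (th * v) / (th * v)))
      with (th * P * sinh (th * v) / v / th ^ 2) in hlt' by (field; lra).
    replace (P * (sinh (th * h) / (th * h)))
      with (th * P * sinh (th * h) / h / th ^ 2) in hlt' by (field; lra).
    rewrite eh, ev in hlt'.
    replace (2 * k * v / v) with (2 * k) in hlt' by (field; lra).
    replace (2 * k * h / h) with (2 * k) in hlt' by (field; lra). lra. }
  intros hu eh eu.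
  destruct (Rtotal_order u 0) as [l | [e | l]]; [| easy |]; exfalso.
  - apply (pos (- u)); [lra | easy |].
    replace (th * - u) with (- (th * u)) by ring. rewrite sinh_opp. lra.
  - apply (pos u); [lra | easy | easy].
Qed.

(** * The full system *)

Definition solution_of (q : R * R) : R * R * R * R * R :=
  let '(A, y) := q in
  (A * exp (- th * xv), A * exp (th * xv), xv - y, xv + y, xv).

Lemma exp_mul_exp_opp t x : exp (t * x) * exp (- t * x) = 1.
Proof.
  rewrite <- exp_plus, <- exp_0. f_equal. ring.
Qed.

Lemma amplitudes_of_solution A :
  even_amplitude (A * exp (- th * xv)) (A * exp (th * xv)) xv = 2 * A /\
  odd_amplitude (A * exp (- th * xv)) (A * exp (th * xv)) xv = 0.
Proof.
  pose proof (exp_mul_exp_opp th xv) as e.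
  unfold even_amplitude, odd_amplitude. split.
  - transitivity (2 * A * (exp (th * xv) * exp (- th * xv))); [ring | rewrite e; ring].
  - ring.
Qed.

Lemma system_of_reduced q :
  solves_reduced_system rho sigma Delta b c q -> snd q < Delta - xv ->
  solves_system rho sigma Delta b c (solution_of q).
Proof.
  destruct q as [A y]. cbn [snd solution_of]. intros hq hy.
  apply reduced_system_hyperbolic in hq as (h1 & h2 & hA & hy0).
  pose proof theta_pos as hth. pose proof upper_room_le_lower_room as hxv.
  destruct (amplitudes_of_solution A) as [hP hQ].
  unfold solves_system. cbv zeta. rewrite !Derive_phi, Derive2_phi.
  set (A1 := A * exp (- th * xv)) in *. set (A2 := A * exp (th * xv)) in *.
  assert (hs : sinh (th * - y) = - sinh (th * y))
    by (rewrite <- sinh_opp; f_equal; ring).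
  assert (hc : cosh (th * - y) = cosh (th * y))
    by (rewrite <- cosh_opp; f_equal; ring).
  assert (f0 : f A1 A2 xv = 2 * A + k0 rho sigma Delta b).
  { rewrite <- (Rplus_0_r xv) at 1.
    rewrite phi_recentred, hP, hQ, Rmult_0_r, cosh_0. ring. }
  assert (d0 : dphi A1 A2 xv = 0).
  { rewrite <- (Rplus_0_r xv) at 1.
    rewrite dphi_recentred, hP, hQ, Rmult_0_r, sinh_0. ring. }
  repeat split; try lra.
  - unfold ddphi. fold (even_amplitude A1 A2 xv). rewrite hP.
    (* The first reduced equation reads [th^2 A = k s / sinh s] at [s = th y]. *)
    assert (hty : 0 < th * y) by now apply Rmult_lt_0_compat.
    pose proof (id_lt_sinh _ hty) as hlt.
    enough (th ^ 2 * A < k) by lra.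
    apply (Rmult_lt_reg_r (th * y)); [easy |].
    apply Rlt_le_trans with (th ^ 2 * A * sinh (th * y)).
    + apply Rmult_lt_compat_l; [| easy].
      apply Rmult_lt_0_compat; [now apply pow_lt | easy].
    + right. transitivity (th * (th * A * sinh (th * y))); [ring | rewrite h1; ring].
  - unfold Rminus. rewrite dphi_recentred, hP, hQ, hs. lra.
  - rewrite dphi_recentred, hP, hQ. lra.
  - rewrite f0. unfold Rminus at 1. rewrite phi_recentred, hP, hQ, hc.
    replace (xv - xv + - y) with (- y) by ring.
    replace ((- y) ^ 2) with (y ^ 2) by ring. lra.
  - rewrite f0, phi_recentred, hP, hQ.
    replace (xv - xv + y) with y by ring. lra.
Qed.

Lemma system_reduces s :
  solves_system rho sigma Delta b c s ->
  exists q, solves_reduced_system rho sigma Delta b c q /\ s = solution_of q.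
Proof.
  destruct s as [[[[A1 A2] xl] xu] xs].
  unfold solves_system. cbv zeta. rewrite !Derive_phi.
  intros ((_ & hls & hsu & _) & (ds & _) & dl & du & fl & fu).
  pose proof theta_pos as hth. pose proof k2_pos as hk.
  set (z := (xl + xu) / 2). set (h := (xu - xl) / 2).
  assert (hh : 0 < h) by (unfold h; lra).
  assert (hxl : xl = z + - h) by (unfold z, h; lra).
  assert (hxu : xu = z + h) by (unfold z, h; lra).
  assert (hxs : xs = z + (xs - z)) by lra.
  assert (hs : sinh (th * - h) = - sinh (th * h))
    by (rewrite <- sinh_opp; f_equal; ring).
  assert (hc : cosh (th * - h) = cosh (th * h))
    by (rewrite <- cosh_opp; f_equal; ring).
  rewrite hxl in dl. rewrite hxu in du.
  assert (flu : f A1 A2 (z + - h) = f A1 A2 (z + h)) by (rewrite <- hxl, <- hxu; lra).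
  rewrite dphi_recentred in dl, du. rewrite !phi_recentred in flu.
  rewrite hs, hc in dl, flu.
  destruct (no_antisymmetric_part (odd_amplitude A1 A2 z) (z - xv) h) as [hm hQ].
  { easy. }
  { ring_simplify in flu. lra. }
  { lra. }
  assert (hz : z = xv) by lra.
  rewrite hxs in ds. rewrite dphi_recentred in ds.
  rewrite hQ, hm in *.
  assert (xsz : xs - z = 0).
  { apply (inner_critical_point (even_amplitude A1 A2 z) h); [lra | lra | lra]. }
  assert (hxs' : xs = z) by lra.
  rewrite hxs', hxu in fu.
  rewrite <- (Rplus_0_r z) in fu at 2.
  rewrite !phi_recentred, hQ, hm, Rmult_0_r, cosh_0 in fu.
  exists (even_amplitude A1 A2 z / 2, h). split.
  - apply reduced_system_hyperbolic. repeat split; [lra | lra | | easy].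
    assert (0 < sinh (th * h)) by now apply sinh_pos, Rmult_lt_0_compat.
    apply (Rmult_lt_reg_r (th * sinh (th * h))); [now apply Rmult_lt_0_compat |].
    assert (0 < k * h) by now apply Rmult_lt_0_compat. lra.
  - cbn [solution_of]. rewrite <- hz.
    (* A vanishing odd amplitude makes both exponentials equal half the even one. *)
    pose proof (exp_mul_exp_opp th z) as e.
    assert (a1 : A1 * exp (th * z) = even_amplitude A1 A2 z / 2)
      by (unfold odd_amplitude, even_amplitude in *; lra).
    assert (a2 : A2 * exp (- th * z) = even_amplitude A1 A2 z / 2)
      by (unfold odd_amplitude, even_amplitude in *; lra).
    repeat apply f_equal2; try lra.
    + rewrite <- a1, Rmult_assoc, e. ring.
    + rewrite <- a2, Rmult_assoc, (Rmult_comm (exp (- th * z))), e. ring.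
Qed.

(** The pasting rule prescribes a value at every point, so each tuple has exactly
    one function and uniqueness of the tuple carries over. *)
Lemma Vtilde_exists_unique s :
  unique (solves_system rho sigma Delta b c) s ->
  exists! V : R -> R, exists s',
    solves_system rho sigma Delta b c s' /\ is_Vtilde rho sigma Delta b c s' V.
Proof.
  intros [hs hu].
  enough (hV : exists! V, is_Vtilde rho sigma Delta b c s V).
  { destruct hV as [V [hV huV]]. exists V. split; [now exists s |].
    intros V' (s' & hs' & hV'). rewrite <- (hu s' hs') in hV'. now apply huV. }
  destruct s as [[[[A1 A2] xl] xu] xs]. clear hs hu.
  unfold is_Vtilde. cbv zeta.
  assert (dec : forall x, {xl < x < xu} + {~ (xl < x < xu)}).
  { intros x. destruct (Rlt_dec xl x); [destruct (Rlt_dec x xu) |]; tauto. }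
  exists (fun x => if dec x then f A1 A2 x else f A1 A2 xs - c). split.
  - intros x. destruct (dec x); tauto.
  - intros V hV. apply functional_extensionality. intros x.
    destruct (hV x) as [hin hout]. destruct (dec x) as [d | d]; symmetry; auto.
Qed.

End Model.

Theorem proposition4p4 (rho sigma Delta b c : R)
    (hrho : 0 < rho) (hsigma : 0 < sigma) (hDelta : 0 < Delta)
    (hb : 0 <= b) (hc : 0 < c)
    (hcbar : c < c_bar rho sigma Delta b) :
  exists s : R * R * R * R * R,
    unique (solves_system rho sigma Delta b c) s /\
    (exists! V : R -> R,
       exists s' : R * R * R * R * R,
         solves_system rho sigma Delta b c s' /\
         is_Vtilde rho sigma Delta b c s' V) /\
    exists A ybar : R,
      unique (solves_reduced_system rho sigma Delta b c) (A, ybar) /\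
      ybar < Delta - x_v Delta b /\
      s = (A * exp (- theta rho sigma * x_v Delta b),
           A * exp (theta rho sigma * x_v Delta b),
           x_v Delta b - ybar,
           x_v Delta b + ybar,
           x_v Delta b).
Proof.
  pose proof (x_v_lt_Delta Delta b hDelta hb) as hxv.
  destruct (reduced_system_unique_solution rho sigma Delta b c
              hrho hsigma hDelta hb (Delta - x_v Delta b) hc ltac:(lra) hcbar)
    as (A & ybar & [hq hu] & hy).
  assert (hs : unique (solves_system rho sigma Delta b c)
                 (solution_of rho sigma Delta b (A, ybar))).
  { split; [now apply system_of_reduced |].
    intros s' hs'.
    destruct (system_reduces rho sigma Delta b c hrho hsigma hDelta hb s' hs')
      as (q' & hq' & ->).
    now rewrite (hu q' hq'). }
  exists (solution_of rho sigma Delta b (A, ybar)).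
  split; [exact hs |]. split; [exact (Vtilde_exists_unique _ _ _ _ _ _ hs) |].
  now exists A, ybar.
Qed.
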